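(* Let $\mathbb{K}=\mathbb{H}$ (quaternions) and $n=6$, or $\mathbb{K}=\mathbf{Ca}$ (Cayley numbers) and $n=14$, and let $S^n=\{(p,w)\in\mathbb{K}\times\mathbb{K} : \Re(p)=0,\ |p|^2+|w|^2=1\}$. Let $\sigma:S^n\to S^n$ be the diffeomorphism $\sigma(p,w)=\bigl(\mathrm{b}(p,w)\,p\,\overline{\mathrm{b}(p,w)},\ \mathrm{b}(p,w)\,w\,\overline{\mathrm{b}(p,w)}\bigr)$ and let $\alpha:S^n\to S^n$, $\alpha(x)=-x$, be the antipodal map. Then the map $\rho=\alpha\circ\sigma$ is a free involution of $S^n$; that is, $\rho\circ\rho=\mathrm{id}$ and $\rho$ has no fixed points.
   Context: $\Re$ denotes the real part. The map $\mathrm{b}:S^n\to\{x\in\mathbb{K}:|x|=1\}$ is defined by $\mathrm{b}(p,w)=\frac{w}{|w|}\,e^{\pi p}\,\frac{\bar w}{|w|}$ if $w\neq0$ and $\mathrm{b}(p,0)=-1$, where for purely imaginary $p$ one has $e^{\pi p}=\cos(\pi|p|)+\sin(\pi|p|)\,\frac{p}{|p|}$ (and $e^0=1$). The map $\mathrm{b}$ is real analytic. In the Cayley case all products are unambiguous, since the subalgebra generated by two elements $p,w$ (together with conjugation) is associative. It is known that $\sigma$ is a real analytic, orientation-preserving diffeomorphism. *)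

(* Defs.v *)
From HB Require Import structures.
From mathcomp Require Import all_boot all_order all_algebra.
From mathcomp Require Import ring.
From mathcomp Require Import all_classical all_reals all_analysis.

Set Implicit Arguments.
Unset Strict Implicit.
Unset Printing Implicit Defensive.

Import Order.TTheory GRing.Theory Num.Theory.

Local Open Scope ring_scope.

(* No associativity or commutativity is imposed on [smul], so that the Cayley
   numbers fit. *)
Record star_alg (R : realType) := StarAlg {
  scarrier :> lmodType R;
  smul : scarrier -> scarrier -> scarrier;
  sone : scarrier;
  sconj : scarrier -> scarrier;
  sre : scarrier -> R }.

Arguments sone {R s}.

Declare Scope star_scope.
Delimit Scope star_scope with star.
Notation "x ** y" := (smul x y) (at level 40, left associativity) : star_scope.
Local Open Scope star_scope.

Definition real_alg (R : realType) : star_alg R :=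
  @StarAlg R R^o (fun x y => x * y) 1 (fun x => x) (fun x => x).

(* Cayley-Dickson doubling. *)
Definition double (R : realType) (A : star_alg R) : star_alg R :=
  @StarAlg R (A * A)%type
    (fun x y => (x.1 ** y.1 - sconj y.2 ** x.2,
                 y.2 ** x.1 + x.2 ** sconj y.1))
    (sone, 0)
    (fun x => (sconj x.1, - x.2))
    (fun x => sre x.1).

Definition quaternion (R : realType) : star_alg R := double (double (real_alg R)).
Definition cayley (R : realType) : star_alg R := double (quaternion R).

(* Two doublings of the reals give Hamilton's quaternions, with the basis
   1, i, j, k = ij. *)
Lemma hamilton_relations (R : realType) :
  let i : quaternion R := ((0, 1), (0, 0)) in
  let j : quaternion R := ((0, 0), (1, 0)) in
  let k : quaternion R := ((0, 0), (0, 1)) in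
  [/\ i ** j = k, i ** i = - sone, j ** j = - sone, k ** k = - sone
    & i ** j ** k = - sone].
Proof.
by split; do 2!apply: injective_projections; rewrite /= !(oppr0, mulr0, mul0r,
  mulr1, mul1r, subr0, sub0r, addr0, add0r, mulrN, mulNr, opprK).
Qed.

Variant division_alg := Quaternions | CayleyNumbers.

Definition algebra_of (R : realType) (k : division_alg) : star_alg R :=
  match k with Quaternions => quaternion R | CayleyNumbers => cayley R end.

Section Maps.
Variables (R : realType) (K : star_alg R).
Implicit Types (p w x : K) (z : K * K).

Definition snorm x : R := Num.sqrt (sre (x ** sconj x)).

(* The exponential e^(pi p), for p purely imaginary only. *)
Definition exp_pi p : K :=
  if p == 0 then sone
  else cos (pi * snorm p) *: sone
       + sin (pi * snorm p) *: ((snorm p)^-1 *: p).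

(* Triple products are bracketed to the left here and in [sigma_fun]; the
   bracketing is immaterial, two elements generating an associative
   subalgebra. *)
Definition bmap z : K :=
  let: (p, w) := z in
  if w == 0 then - sone
  else ((snorm w)^-1 *: w) ** exp_pi p ** ((snorm w)^-1 *: sconj w).

Definition in_sphere z : bool :=
  (sre z.1 == 0) && (snorm z.1 ^+ 2 + snorm z.2 ^+ 2 == 1).

Definition sigma_fun z : K * K :=
  let b := bmap z in (b ** z.1 ** sconj b, b ** z.2 ** sconj b).

End Maps.

(* The sphere S^6 for the quaternions and S^14 for the Cayley numbers. *)
Definition sphere (R : realType) (k : division_alg) :=
  {z : algebra_of R k * algebra_of R k | in_sphere z}.

Section Sphere.
Variables (R : realType) (k : division_alg).
Local Notation K := (algebra_of R k).
Implicit Types (p w x y : K) (a c : R) (z : K * K).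

Local Notation nsq x := (sre (x ** sconj x)).


Local Ltac coordinates :=
  intros; simpl in *;
  repeat match goal with x : (_ * _)%type |- _ => destruct x end;
  simpl in *; unfold GRing.scale; simpl; unfold GRing.regular in *.

Lemma nsqM x y : nsq (x ** y) = nsq x * nsq y.
Proof. by case: k x y; coordinates; ring. Qed.

Lemma nsqZ a x : nsq (a *: x) = a ^+ 2 * nsq x.
Proof. by case: k x; coordinates; ring. Qed.

Lemma nsqN x : nsq (- x) = nsq x.
Proof. by case: k x; coordinates; ring. Qed.

Lemma nsq_conj x : nsq (sconj x) = nsq x.
Proof. by case: k x; coordinates; ring. Qed.

Lemma nsq1 : nsq (sone : K) = 1.
Proof. by case: k; coordinates; ring. Qed.

Lemma nsq_exp a c p : sre p = 0 -> nsq (a *: sone + c *: p) = a ^+ 2 + c ^+ 2 * nsq p.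
Proof.
by case: k p => [[[? ?] [? ?]] | [[[? ?] [? ?]] [[? ?] [? ?]]]] /= ->;
  coordinates; ring.
Qed.

Lemma sre_conjugate x p : sre (x ** p ** sconj x) = nsq x * sre p.
Proof. by case: k x p; coordinates; ring. Qed.

Lemma sreN x : sre (- x) = - sre x.
Proof. by case: k x. Qed.

Let nsq_ge0_eq0 x : 0 <= nsq x /\ (nsq x = 0 -> x = 0).
Proof.
have sq0 (y : R) : y ^+ 2 = 0 -> y = 0 by move/eqP; rewrite sqrf_eq0 => /eqP.
have sum0 (y z : R) : 0 <= y -> 0 <= z -> y + z = 0 -> y = 0 /\ z = 0.
  by move=> y0 z0 /eqP; rewrite paddr_eq0// => /andP[/eqP -> /eqP ->].
have H (u : quaternion R) : 0 <= nsq u /\ (nsq u = 0 -> u = 0).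
  have -> : nsq u = u.1.1 ^+ 2 + u.1.2 ^+ 2 + u.2.1 ^+ 2 + u.2.2 ^+ 2.
    by coordinates; ring.
  case: u => [[u0 u1] [u2 u3]] /=.
  split=> [|/sum0[||/sum0[||/sum0[||]]]]; rewrite ?addr_ge0 ?sqr_ge0//.
  by move=> /sq0-> /sq0-> /sq0-> /sq0->.
case: k x => [//|x]; have [[u0 u1] [v0 v1]] := (H x.1, H x.2).
have -> : nsq x = nsq x.1 + nsq x.2.
  by clear; coordinates; ring.
split=> [|/sum0[]//]; first exact: addr_ge0.
by case: x u0 u1 v0 v1 => u v /= _ u1 _ v1 /u1-> /v1->.
Qed.

Lemma snorm_sqr x : snorm x ^+ 2 = nsq x.
Proof. by rewrite sqr_sqrtr//; case: (nsq_ge0_eq0 x). Qed.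

Lemma snorm_eq0 x : snorm x = 0 -> x = 0.
Proof.
by move=> x0; apply: (nsq_ge0_eq0 x).2; rewrite -snorm_sqr x0 expr0n.
Qed.

Lemma nsq_normalize x y : x != 0 -> nsq y = nsq x ->
  nsq ((snorm x)^-1 *: y) = 1.
Proof.
move=> x0 yx; rewrite nsqZ yx -snorm_sqr -exprMn mulVf ?expr1n//.
by apply: contra_neq x0 => /snorm_eq0.
Qed.

Lemma nsq_exp_pi p : sre p = 0 -> nsq (exp_pi p) = 1.
Proof.
move=> p_im; rewrite /exp_pi; case: eqVneq => [_|p0]; first exact: nsq1.
rewrite scalerA nsq_exp// exprMn -mulrA -nsqZ nsq_normalize// mulr1.
exact: cos2Dsin2.
Qed.

Lemma nsq_bmap z : sre z.1 = 0 -> nsq (bmap z) = 1.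
Proof.
case: z => p w /= p_im; case: eqVneq => [_|w0]; first by rewrite nsqN nsq1.
by rewrite !nsqM nsq_exp_pi// !nsq_normalize ?nsq_conj// !mulr1.
Qed.

Lemma sigma_sphere z : in_sphere z -> in_sphere (sigma_fun z).
Proof.
case/andP=> /eqP p_im /eqP z1; rewrite /in_sphere /= sre_conjugate p_im mulr0.
by rewrite eqxx !snorm_sqr !nsqM nsq_conj nsq_bmap// !mulr1 !mul1r -!snorm_sqr z1 eqxx.
Qed.

Lemma opp_sphere z : in_sphere z -> in_sphere (- z).
Proof.
by rewrite /in_sphere !snorm_sqr /= !nsqN sreN oppr_eq0.
Qed.

Definition sigma (x : sphere R k) : sphere R k :=
  exist _ (sigma_fun (val x)) (sigma_sphere (valP x)).

Definition antipode (x : sphere R k) : sphere R k :=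
  exist _ (- val x) (opp_sphere (valP x)).

Definition rho : sphere R k -> sphere R k := antipode \o sigma.

End Sphere.

Definition free_involution (T : Type) (f : T -> T) : Prop :=
  involutive f /\ forall x, f x <> x.

(* Main.v *)
(* Write C_b x = b x b^-1 with b = bmap (p, w), so that rho (p, w) is
   (- C_b p, - C_b w). On the associative subalgebra generated by p and w the
   map C_b is an automorphism commuting with conjugation, so bmap takes the
   value C_b b = b at (C_b p, C_b w). As bmap (- p, - w) is the conjugate of
   bmap (p, w), the value of bmap at rho (p, w) is the conjugate of b. Hence
   applying rho twice undoes C_b, and at a fixed point b is real, so that C_b
   is the identity and (p, w) = - (p, w).
   Associativity (Artin's theorem) holds because the product of linear
   combinations of 1, x, y, xy is given by structure constants polynomial in
   the invariants of x and y, for which associativity is a polynomial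
   identity; 1, x, y, xy need not be independent. *)
Require Import Defs.
From mathcomp Require Import all_boot all_order all_algebra.
From mathcomp Require Import ring.
From mathcomp Require Import all_classical all_reals all_analysis.

Set Implicit Arguments.
Unset Strict Implicit.
Unset Printing Implicit Defensive.

Import Order.TTheory GRing.Theory Num.Theory.

Local Open Scope ring_scope.
Local Open Scope star_scope.

(** * Arithmetic of combinations of 1, x, y, xy *)

Section LinearCombinations.
Variables (R : realType) (A : star_alg R).
Implicit Types (x y : A) (c d : R * R * R * R).

Definition lincomb x y c : A :=
  let: (c0, c1, c2, c3) := c in
  c0 *: sone + c1 *: x + c2 *: y + c3 *: (x ** y).

(* The multiplication table of 1, x, y, xy, obtained from
   xx = a x - n, yy = b y - m, yx = a y + b x - h - xy
   and the alternative laws. *)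
Definition lincomb_mul x y c d : R * R * R * R :=
  let: (c0, c1, c2, c3) := c in let: (d0, d1, d2, d3) := d in
  let a := 2 * sre x in let b := 2 * sre y in
  let n := sre (x ** sconj x) in let m := sre (y ** sconj y) in
  let g := 2 * sre (x ** y) in
  let h := a * b - g in
  (c0 * d0 - c1 * d1 * n - c2 * d1 * h - c2 * d2 * m - c2 * d3 * a * m
     - c3 * d1 * b * n - c3 * d3 * n * m,
   c0 * d1 + c1 * d0 + c1 * d1 * a + c2 * d1 * b + c2 * d3 * m
     + c3 * d1 * g - c3 * d2 * m,
   c0 * d2 + c2 * d0 - c1 * d3 * n + c2 * d1 * a + c2 * d2 * b
     + c2 * d3 * g + c3 * d1 * n,
   c0 * d3 + c3 * d0 + c1 * d2 + c1 * d3 * a - c2 * d1 + c3 * d2 * b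
     + c3 * d3 * g).

(** Conjugation sends z to 2 Re(z) - z, so the real parts of x, y and xy enter only the coefficient
    of 1. *)
Definition lincomb_conj x y c : R * R * R * R :=
  let: (c0, c1, c2, c3) := c in
  (c0 + 2 * (c1 * sre x + c2 * sre y + c3 * sre (x ** y)), - c1, - c2, - c3).

Lemma lincomb_mulA x y c d e :
  lincomb_mul x y c (lincomb_mul x y d e) =
  lincomb_mul x y (lincomb_mul x y c d) e.
Proof.
case: c d e => [[[? ?] ?] ?] [[[? ?] ?] ?] [[[? ?] ?] ?].
rewrite /lincomb_mul.
set n := sre (x ** sconj x); set m := sre (y ** sconj y).
set a := 2 * sre x; set b := 2 * sre y; set g := 2 * sre (x ** y).
(* Associativity holds with the invariants as free variables, so their definitions are dropped. *)
by clearbody a b n m g; congr (_, _, _, _); ring.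
Qed.

Definition in_span x y (z : A) : Prop := exists c, z = lincomb x y c.

Definition conjugate x y : A := x ** y ** sconj x.

End LinearCombinations.

Section DivisionAlgebra.
Variables (R : realType) (k : division_alg).
Local Notation K := (algebra_of R k).
Implicit Types (b p u v w x y z : K) (a : R).
Local Notation nsq x := (sre (x ** sconj x)).

Local Ltac coordinates :=
  intros; simpl in *;
  repeat match goal with x : (_ * _)%type |- _ => destruct x end;
  repeat apply: injective_projections;
  simpl in *; unfold GRing.scale; simpl; unfold GRing.regular in *; ring.

(** * Laws of both algebras, checked in coordinates *)

Lemma smulDl x y z : (x + y) ** z = x ** z + y ** z.
Proof. case: k x y z; coordinates. Qed.

Lemma smulDr x y z : z ** (x + y) = z ** x + z ** y.
Proof. case: k x y z; coordinates. Qed.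

Lemma smulZl a x y : (a *: x) ** y = a *: (x ** y).
Proof. case: k x y; coordinates. Qed.

Lemma smulZr a x y : x ** (a *: y) = a *: (x ** y).
Proof. case: k x y; coordinates. Qed.

Lemma smul1x x : sone ** x = x.
Proof. case: k x; coordinates. Qed.

Lemma smulx1 x : x ** sone = x.
Proof. case: k x; coordinates. Qed.

Lemma sconjD x y : sconj (x + y) = sconj x + sconj y.
Proof. case: k x y; coordinates. Qed.

Lemma sconjZ a x : sconj (a *: x) = a *: sconj x.
Proof. case: k x; coordinates. Qed.

Lemma sconjK x : sconj (sconj x) = x.
Proof. case: k x; coordinates. Qed.

Lemma sconjM x y : sconj (x ** y) = sconj y ** sconj x.
Proof. case: k x y; coordinates. Qed.

Lemma sconjE x : sconj x = (2 * sre x) *: sone - x.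
Proof. case: k x; coordinates. Qed.

Lemma smul_conj x : x ** sconj x = nsq x *: sone.
Proof. case: k x; coordinates. Qed.

Lemma lincombM x y c d :
  lincomb x y c ** lincomb x y d = lincomb x y (lincomb_mul x y c d).
Proof.
case: c d => [[[? ?] ?] ?] [[[? ?] ?] ?]; rewrite /lincomb_mul.
case: k x y; coordinates.
Qed.

Lemma lincomb_conjE x y c :
  sconj (lincomb x y c) = lincomb x y (lincomb_conj x y c).
Proof.
case: c => [[[? ?] ?] ?]; rewrite /lincomb_conj; case: k x y; coordinates.
Qed.

(** * The subalgebra generated by two elements *)

Lemma in_spanM x y u v : in_span x y u -> in_span x y v -> in_span x y (u ** v).
Proof. by move=> [c ->] [d ->]; rewrite lincombM; eexists. Qed.

Lemma in_span_conj x y u : in_span x y u -> in_span x y (sconj u).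
Proof. by move=> [c ->]; rewrite lincomb_conjE; eexists. Qed.

Lemma in_spanZ x y a u : in_span x y u -> in_span x y (a *: u).
Proof.
move=> [[[[c0 c1] c2] c3] ->]; exists (a * c0, a * c1, a * c2, a * c3).
by rewrite /= !scalerDr !scalerA.
Qed.

Lemma in_spanD x y u v : in_span x y u -> in_span x y v -> in_span x y (u + v).
Proof.
move=> [[[[c0 c1] c2] c3] ->] [[[[d0 d1] d2] d3] ->].
exists (c0 + d0, c1 + d1, c2 + d2, c3 + d3).
rewrite /= !scalerDl addrACA; congr (_ + _); rewrite addrACA; congr (_ + _).
exact: addrACA.
Qed.

Lemma in_span1 x y : in_span x y sone.
Proof. by exists (1, 0, 0, 0); rewrite /= !scale0r !addr0 scale1r. Qed.

Lemma in_spanl x y : in_span x y x.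
Proof. by exists (0, 1, 0, 0); rewrite /= !scale0r !addr0 add0r scale1r. Qed.

Lemma in_spanr x y : in_span x y y.
Proof. by exists (0, 0, 1, 0); rewrite /= !scale0r addr0 !add0r scale1r. Qed.

Lemma artin x y u v w : in_span x y u -> in_span x y v -> in_span x y w ->
  u ** (v ** w) = u ** v ** w.
Proof. by move=> [c ->] [d ->] [e ->]; rewrite !lincombM lincomb_mulA. Qed.

Local Hint Resolve in_spanM in_span_conj in_spanZ in_spanD : core.
Local Hint Resolve in_span1 in_spanl in_spanr : core.

Lemma smulKl x y : nsq x = 1 -> sconj x ** (x ** y) = y.
Proof.
move=> x1; rewrite (@artin x y)//; last exact: in_span_conj.
by rewrite -{2}[x]sconjK smul_conj nsq_conj x1 scale1r smul1x.
Qed.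

Lemma smulKr x y : nsq x = 1 -> y ** sconj x ** x = y.
Proof.
move=> x1; rewrite -(@artin x y)//; last exact: in_span_conj.
by rewrite -{2}[x]sconjK smul_conj nsq_conj x1 scale1r smulx1.
Qed.

(** * Conjugation maps *)

Lemma conjugateD b x y : conjugate b (x + y) = conjugate b x + conjugate b y.
Proof. by rewrite /conjugate smulDr smulDl. Qed.

Lemma conjugateZ b a x : conjugate b (a *: x) = a *: conjugate b x.
Proof. by rewrite /conjugate smulZr smulZl. Qed.

Lemma conjugateN b x : conjugate b (- x) = - conjugate b x.
Proof. by rewrite -scaleN1r conjugateZ scaleN1r. Qed.

Lemma conjugate0 b : conjugate b 0 = 0.
Proof. by rewrite -(scale0r 0) conjugateZ !scale0r. Qed.

Lemma conjugate_conj b x : sconj (conjugate b x) = conjugate b (sconj x).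
Proof.
rewrite /conjugate !sconjM sconjK (@artin b x)//; last exact: in_span_conj.
exact: in_span_conj.
Qed.

(** At norm 1 the inverse of [b] is [sconj b]; the factors cancel first on the left, then on the
    right. *)
Lemma conjugateK b x : nsq b = 1 -> conjugate (sconj b) (conjugate b x) = x.
Proof.
move=> b1; rewrite /conjugate sconjK -(@artin b x b)//; last exact: in_span_conj.
by rewrite smulKl// smulKr.
Qed.

Lemma conjugate_eq0 b x : nsq b = 1 -> (conjugate b x == 0) = (x == 0).
Proof.
move=> b1; apply/eqP/eqP => [bx0|->]; last exact: conjugate0.
by rewrite -(conjugateK x b1) bx0 conjugate0.
Qed.

Lemma conjugate_unit b : nsq b = 1 -> conjugate b sone = sone.
Proof. by move=> b1; rewrite /conjugate smulx1 smul_conj b1 scale1r. Qed.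

Lemma conjugate_self b : nsq b = 1 -> conjugate b b = b.
Proof.
move=> b1; rewrite /conjugate -(@artin b b)//; last exact: in_span_conj.
by rewrite smul_conj b1 scale1r smulx1.
Qed.

Lemma snorm_conjugate b x : nsq b = 1 -> snorm (conjugate b x) = snorm x.
Proof. by move=> b1; rewrite /snorm !nsqM nsq_conj b1 mulr1 mul1r. Qed.

(* Conjugation by a unit octonion is not multiplicative on the whole algebra. *)
Lemma conjugateM x y b u v : nsq b = 1 ->
  in_span x y b -> in_span x y u -> in_span x y v ->
  conjugate b (u ** v) = conjugate b u ** conjugate b v.
Proof.
move=> b1 sb su sv; have sb' := in_span_conj sb.
(* Rebracketing brings the inner [sconj b] next to [b], where they cancel. *)
rewrite /conjugate -(@artin x y (b ** u)); auto.
rewrite (@artin x y (sconj b)); auto.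
by rewrite smulKl// (@artin x y b)// (@artin x y (b ** u)); auto.
Qed.

(** * Symmetries of the exponential and of [bmap] *)

(** The exponential combines 1 and [p] with coefficients depending only on the norm; conjugation by
    [b] is linear, fixes 1 and preserves norms. *)
Lemma exp_pi_conjugate b p : nsq b = 1 ->
  exp_pi (conjugate b p) = conjugate b (exp_pi p).
Proof.
move=> b1; rewrite /exp_pi conjugate_eq0// snorm_conjugate//.
case: ifP => _; first by rewrite conjugate_unit.
by rewrite conjugateD !conjugateZ conjugate_unit.
Qed.

Lemma snormN x : snorm (- x) = snorm x.
Proof. by rewrite /snorm nsqN. Qed.

Lemma sconj1 : sconj sone = sone :> K.
Proof. case: k; coordinates. Qed.

Lemma sconj_imaginary p : sre p = 0 -> sconj p = - p.
Proof. by move=> p0; rewrite sconjE p0 mulr0 scale0r sub0r. Qed.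

Lemma exp_piN p : sre p = 0 -> exp_pi (- p) = sconj (exp_pi p).
Proof.
move=> p0; rewrite /exp_pi oppr_eq0 snormN.
case: ifP => _; first by rewrite sconj1.
by rewrite sconjD !sconjZ sconj1 sconj_imaginary.
Qed.

(** A self-adjoint [b] is a real multiple of 1, here by a scalar of square 1. *)
Lemma conjugate_selfadjoint b x : sconj b = b -> nsq b = 1 -> conjugate b x = x.
Proof.
move=> b_self b1; have bE : b = sre b *: sone.
  apply: (scalerI (_ : 2 != 0)); first by rewrite pnatr_eq0.
  by rewrite scalerA scaler_nat mulr2n -{1}b_self sconjE subrK.
rewrite bE nsqZ nsq1 mulr1 expr2 in b1.
rewrite /conjugate bE smulZl smul1x sconjZ sconj1 smulZr smulx1.
by rewrite scalerA b1 scale1r.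
Qed.

Lemma in_span_exp_pi p w : in_span p w (exp_pi p).
Proof. by rewrite /exp_pi; case: ifP => _; auto 6. Qed.

Local Hint Resolve in_span_exp_pi : core.

(** This allows [conjugateM] to be used with [b] equal to [bmap (p, w)] itself. *)
Lemma in_span_bmap p w : in_span p w (bmap (p, w)).
Proof.
rewrite /bmap; case: ifP => _; last by auto 6.
by rewrite -scaleN1r; auto.
Qed.

(** Norms, conjugates, exponentials and products inside the span are all respected by conjugation by
    [b]; the case [w = 0] is too, since conjugation is injective and fixes -1. *)
Lemma bmap_conjugate b p w : nsq b = 1 -> in_span p w b ->
  bmap (conjugate b p, conjugate b w) = conjugate b (bmap (p, w)).
Proof.
move=> b1 sb; rewrite /bmap conjugate_eq0//; case: ifP => _.
  by rewrite conjugateN conjugate_unit.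
rewrite snorm_conjugate// exp_pi_conjugate// conjugate_conj -!conjugateZ.
by rewrite -!(@conjugateM p w); auto 6.
Qed.

Lemma bmapN p w : sre p = 0 -> bmap (- p, - w) = sconj (bmap (p, w)).
Proof.
move=> p0; rewrite /bmap oppr_eq0 snormN; case: ifP => _.
  by rewrite -scaleN1r sconjZ sconj1.
(* Conjugating the triple product leaves it bracketed to the right; [artin] rebrackets it, and the
   two signs coming from [- w] cancel. *)
rewrite exp_piN// -[- w]scaleN1r sconjZ !sconjM !sconjZ sconjK.
rewrite !(scalerA _ (-1)) ![_ * -1]mulrC -!scalerA.
rewrite (@artin p w); auto.
by rewrite !(smulZl (-1)) (smulZr (-1)) scalerA mulrNN mulr1 scale1r.
Qed.

End DivisionAlgebra.

Theorem theorem1 (R : realType) (k : division_alg) :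
  free_involution (@rho R k).
Proof.
have bmap_rho (x : sphere R k) :
    bmap (val (rho x)) = sconj (bmap (val x)).
  case: x => [[p w] pw] /=; have /andP[/eqP /= p0 _] := pw.
  have b1 := nsq_bmap (z := (p, w)) p0.
  have sb := in_span_bmap p w.
  change (bmap (- conjugate (bmap (p, w)) p, - conjugate (bmap (p, w)) w) =
    sconj (bmap (p, w))).
  rewrite bmapN; last by rewrite sre_conjugate p0 mulr0.
  by rewrite bmap_conjugate// conjugate_self.
have rhoE (x : sphere R k) : val (rho x) =
    (- conjugate (bmap (val x)) (val x).1, - conjugate (bmap (val x)) (val x).2).
  by [].
have b1 (x : sphere R k) : sre (bmap (val x) ** sconj (bmap (val x))) = 1.
  by apply: nsq_bmap; case/andP: (valP x) => /eqP.
split=> x.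
  apply: val_inj; rewrite rhoE bmap_rho rhoE /= !conjugateN !opprK.
  by rewrite !(conjugateK _ (b1 x)) -surjective_pairing.
move=> fix_x; have := bmap_rho x; rewrite fix_x => b_real.
have fixed_eq0 y : y = - conjugate (bmap (val x)) y -> y = 0.
  rewrite conjugate_selfadjoint// => /eqP; rewrite -addr_eq0 -mulr2n -scaler_nat.
  by rewrite scaler_eq0 pnatr_eq0 /= => /eqP.
have := rhoE x; rewrite fix_x.
case: x {rhoE b1 fix_x b_real bmap_rho} fixed_eq0 => [[p w] pw] /= fixed_eq0.
case=> /fixed_eq0 p0 /fixed_eq0 w0; case/andP: pw => _.
(* Writing 0 as [0 *: 0] lets [nsqZ] give it norm 0, against norm 1 on the sphere. *)
rewrite !snorm_sqr /= p0 w0 -(scale0r 0) !nsqZ expr0n /= !mul0r addr0.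
by rewrite eq_sym oner_eq0.
Qed.
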